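(* Let $(E,\omega)$ be a vertex weighted row-finite graph. Then there is a unique isomorphism of $*$-algebras $$\Phi\colon L(E,\omega)\longrightarrow LW(E(\omega),C(\omega))$$ such that $\Phi(v)=p_{v_1}$ for every $v\in E^0$ and $\Phi(e_i)=\rho(h(s(e),i),\tilde e)$ for every $e\in E^1$ and $1\le i\le \omega(s(e))$. (Under the identification of $LW(E(\omega),C(\omega))$ with a corner of $L(E(\omega),C(\omega))$ described in the context, these read $\Phi(v)=v_1$ and $\Phi(e_i)=h(s(e),i)^*\tilde e$.)
   Context: Fix a field $K$ with an involution $*$. All algebras are $*$-algebras over $K$ (not necessarily unital), and all presentations by generators and relations are taken in the category of $*$-algebras. A directed graph is $E=(E^0,E^1,r,s)$. It is row-finite if $s^{-1}(v)$ is finite for all $v\in E^0$; $E^0_{\mathrm{reg}}$ is the set of $v$ with $s^{-1}(v)\neq\emptyset$. An isolated vertex is a $v$ with $s^{-1}(v)=r^{-1}(v)=\emptyset$. Weighted graphs: a weighted graph is a pair $(E,\omega)$ with $E$ a row-finite graph with no isolated vertices and $\omega\colon E^1\to\mathbb N=\{1,2,\dots\}$ a map. For $v\in E^0_{\mathrm{reg}}$ put $\omega(v)=\max\{\omega(e):e\in s^{-1}(v)\}$, and $\omega(v)=0$ if $v$ is a sink. $(E,\omega)$ is a vertex weighted graph if $\omega(e)=\omega(v)$ for all $v \in E^0_{\mathrm{reg}}$ and $e\in s^{-1}(v)$. The weighted Leavitt path algebra $L(E,\omega)$ is the $*$-algebra generated by $\{v,e_i\mid v\in E^0,e\in E^1,1\le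 i\le\omega(e)\}$ subject to: (1) $uv=\delta_{u,v}u$ and $v=v^*$ for $u,v\in E^0$; (2) $s(e)e_i=e_i=e_ir(e)$; (3) $\sum_{e\in s^{-1}(v)}e_ie_j^*=\delta_{ij}v$ for $v\in E^0_{\mathrm{reg}}$, $1\le i,j\le\omega(v)$; (4) $\sum_{1\le i\le\omega(v)}e_i^*f_i=\delta_{e,f}r(e)$ for $v\in E^0_{\mathrm{reg}}$, $e,f\in s^{-1}(v)$; where in (3),(4) $e_i$ and $e_i^*$ are zero whenever $i>\omega(e)$. Separated graphs: a separated graph is a pair $(F,D)$ with $F$ a directed graph and $D=\bigcup_{v\in F^0}D_v$, where $D_v$ is a partition of $s^{-1}(v)$ into pairwise disjoint nonempty subsets. It is bipartite if $F^0=F^{0,0}\sqcup F^{0,1}$ with $s(e)\in F^{0,0}$ and $r(e)\in F^{0,1}$ for all $e\in F^1$. For $e\in F^1$, $X_e$ is the unique element of $D$ containing $e$. The Leavitt path algebra $L(F,D)$ is the $*$-algebra with generators $F^0\sqcup F^1$ and relations $vv'=\delta_{v,v'}v$, $v=v^*$ ($v,v'\in F^0$); $s(e)e=e=er(e)$ ($e\in F^1$); $e^*f=\delta_{e,f}r(e)$ for $e,f\in X$, $X\in D$; $v=\sum_{e\in X}ee^*$ for every finite $X\in D_v$, $v\in F^0$. Lower Leavitt path algebra: for a row-finite bipartite separated graph $(F,D)$ with $s(F^1)=F^{0,0}$ and $r(F^1)=F^{0,1}$, $LW(F,D)$ is the universal $*$-algebra with generators $\{p_w\}_{w\in F^{0,1}}$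 and $\{\rho(e,f): e,f\in F^1,\ s(e)=s(f),\ X_e\ne X_f\}$ and relations: $p_wp_{w'}=\delta_{w,w'}p_w$, $p_w^*=p_w$; $\rho(e,f)^*=\rho(f,e)$; $\rho(e,f)p_{r(f)}=p_{r(e)}\rho(e,f)=\rho(e,f)$; and whenever $e,h\in F^1$, $v:=s(e)=s(h)$, $X\in D_v$, $X\neq X_e$, $X\ne X_h$: $\sum_{f\in X}\rho(e,f)\rho(f,h)=\delta_{e,h}p_{r(e)}$ if $X_e=X_h$, and $=\rho(e,h)$ if $X_e\ne X_h$. It is identified with the corner $W L(F,D) W$, $W=\sum_{w\in F^{0,1}}w$, via $p_w\mapsto w$, $\rho(e,f)\mapsto e^*f$. The separated graph of a vertex weighted graph $(E,\omega)$: let $V_0,V_1$ be two copies of $E^0$ with bijections $v\mapsto v_i$, $i=0,1$. Put $E(\omega)^{0,0}=\{v_0\mid v\in E^0_{\mathrm{reg}}\}$, $E(\omega)^{0,1}=V_1$, $E(\omega)^0=E(\omega)^{0,0}\sqcup E(\omega)^{0,1}$. For each $e\in E^1$ there is an edge $\tilde e$ with $s(\tilde e)=s(e)_0$, $r(\tilde e)=r(e)_1$. For $v\in E^0_{\mathrm{reg}}$ put $X_v=\{\tilde e\mid e\in s^{-1}(v)\}$ and $Y_v=\{h(v,i):1\le i\le\omega(v)\}$, where $h(v,i)$ are further distinct edges with $s(h(v,i))=v_0$, $r(h(v,i))=v_1$. Set $C(\omega)_{v_0}=\{X_v,Y_v\}$ and $E(\omega)^1=\bigsqcup_{v\in E^0_{\mathrm{reg}}}(X_v\sqcup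 Y_v)$. *)

(* Defs.v *)
From HB Require Import structures.
From mathcomp Require Import all_boot all_order all_algebra.
From mathcomp Require Import all_classical finmap.

Set Implicit Arguments.
Unset Strict Implicit.
Unset Printing Implicit Defensive.

Import GRing.Theory.

Local Open Scope classical_set_scope.
Local Open Scope ring_scope.
Local Open Scope quotient_scope.

(* Not necessarily unital *-algebras over K; the involution of K is [conj]
   (the hypothesis [involutive conj] is stated where it is used). *)

HB.mixin Record Lmodule_isStarAlgebra (K : fieldType)
    (conj : {rmorphism K -> K}) A of GRing.Lmodule K A := {
  smul : A -> A -> A;
  star : A -> A;
  smulA : associative smul;
  smulDl : left_distributive smul +%R;
  smulDr : right_distributive smul +%R;
  scale_smull : forall (a : K) (x y : A), smul (a *: x) y = a *: smul x y;
  scale_smulr : forall (a : K) (x y : A), smul x (a *: y) = a *: smul x y;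
  starD : forall x y : A, star (x + y) = star x + star y;
  starZ : forall (a : K) (x : A), star (a *: x) = conj a *: star x;
  starM : forall x y : A, star (smul x y) = smul (star y) (star x);
  starK : involutive star }.

#[short(type="starAlgType")]
HB.structure Definition StarAlgebra (K : fieldType) (conj : {rmorphism K -> K})
  := { A of GRing.Lmodule K A & Lmodule_isStarAlgebra K conj A }.

Definition star_hom (K : fieldType) (conj : {rmorphism K -> K})
    (A B : starAlgType conj) (f : A -> B) : Prop :=
  [/\ linear f,
      forall x y, f (smul x y) = smul (f x) (f y)
    & forall x, f (star x) = star (f x)].

Definition star_iso (K : fieldType) (conj : {rmorphism K -> K})
    (A B : starAlgType conj) (f : A -> B) : Prop :=
  star_hom f /\ bijective f.

(* Presentations: *-algebra expressions in the generators X, modulo the least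
   congruence containing the *-algebra axioms and the relations R. *)

Inductive term (K X : Type) : Type :=
| TGen of X
| TZero
| TAdd of term K X & term K X
| TScale of K & term K X
| TMul of term K X & term K X
| TStar of term K X.

Arguments TZero {K X}.
Arguments TGen {K X}.

HB.instance Definition _ (K X : Type) := gen_eqMixin (term K X).
HB.instance Definition _ (K X : Type) := gen_choiceMixin (term K X).

Declare Scope sterm_scope.
Delimit Scope sterm_scope with ST.
Bind Scope sterm_scope with term.
Notation "0" := TZero : sterm_scope.
Notation "x + y" := (TAdd x y) : sterm_scope.
Notation "x * y" := (TMul x y) : sterm_scope.
Notation "a *: x" := (TScale a x) : sterm_scope.
Notation "x ^*" := (TStar x) : sterm_scope.
Notation "\sum_ ( i <- s ) F" := (\big[@TAdd _ _/TZero]_(i <- s) F%ST) : sterm_scope.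

Section Presentation.
Variables (K : fieldType) (conj : {rmorphism K -> K}) (X : Type).
Variable R : term K X -> term K X -> Prop.

Inductive pres_eq : term K X -> term K X -> Prop :=
| PE_rel x y : R x y -> pres_eq x y
| PE_refl x : pres_eq x x
| PE_sym x y : pres_eq x y -> pres_eq y x
| PE_trans x y z : pres_eq x y -> pres_eq y z -> pres_eq x z
| PE_add x x' y y' :
    pres_eq x x' -> pres_eq y y' -> pres_eq (x + y) (x' + y')
| PE_scale a x x' : pres_eq x x' -> pres_eq (a *: x) (a *: x')
| PE_mul x x' y y' :
    pres_eq x x' -> pres_eq y y' -> pres_eq (x * y) (x' * y')
| PE_star x x' : pres_eq x x' -> pres_eq (x ^*) (x' ^*)
| PE_addA x y z : pres_eq (x + (y + z)) ((x + y) + z)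
| PE_addC x y : pres_eq (x + y) (y + x)
| PE_add0 x : pres_eq (0 + x) x
| PE_addN x : pres_eq ((-1)%R *: x + x) 0
| PE_scaleA a b x : pres_eq (a *: (b *: x)) ((a * b)%R *: x)
| PE_scale1 x : pres_eq (1%R *: x) x
| PE_scaleDr a x y : pres_eq (a *: (x + y)) (a *: x + a *: y)
| PE_scaleDl a b x : pres_eq ((a + b)%R *: x) (a *: x + b *: x)
| PE_mulA x y z : pres_eq (x * (y * z)) ((x * y) * z)
| PE_mulDl x y z : pres_eq ((x + y) * z) (x * z + y * z)
| PE_mulDr x y z : pres_eq (x * (y + z)) (x * y + x * z)
| PE_scaleAl a x y : pres_eq ((a *: x) * y) (a *: (x * y))
| PE_scaleAr a x y : pres_eq (x * (a *: y)) (a *: (x * y))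
| PE_starD x y : pres_eq ((x + y) ^*) (x ^* + y ^*)
| PE_starZ a x : pres_eq ((a *: x) ^*) (conj a *: x ^*)
| PE_starM x y : pres_eq ((x * y) ^*) (y ^* * x ^*)
| PE_starK x : pres_eq (x ^* ^*) x.

Definition pres_rel (x y : term K X) : bool := `[< pres_eq x y >].

Lemma pres_rel_refl : reflexive pres_rel.
Proof. by move=> x; apply/asboolP/PE_refl. Qed.
Lemma pres_rel_sym : symmetric pres_rel.
Proof. by move=> x y; apply/asboolP/asboolP => /PE_sym. Qed.
Lemma pres_rel_trans : transitive pres_rel.
Proof.
by move=> y x z /asboolP xy /asboolP yz; apply/asboolP/(PE_trans xy yz).
Qed.

Canonical pres_equiv :=
  EquivRel pres_rel pres_rel_refl pres_rel_sym pres_rel_trans.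

Definition pres : Type := {eq_quot pres_equiv}.
HB.instance Definition _ := Choice.on pres.
HB.instance Definition _ := Quotient.on pres.

Definition pres_cls (x : term K X) : pres := \pi_pres x.
Definition pres_gen (x : X) : pres := pres_cls (TGen x).

Lemma pres_clsP x y : pres_cls x = pres_cls y <-> pres_eq x y.
Proof.
split=> [/eqP|H]; first by rewrite eqmodE => /asboolP.
by apply/eqP; rewrite eqmodE; apply/asboolP.
Qed.

Lemma pres_clsK (u : pres) : pres_cls (repr u) = u.
Proof. exact: reprK. Qed.

Lemma repr_pres_cls x : pres_eq (repr (pres_cls x)) x.
Proof. by apply/pres_clsP; rewrite pres_clsK. Qed.

Definition pres_add (u v : pres) : pres := pres_cls (repr u + repr v).
Definition pres_opp (u : pres) : pres := pres_cls ((-1)%R *: repr u).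
Definition pres_scale (a : K) (u : pres) : pres := pres_cls (a *: repr u).
Definition pres_mul (u v : pres) : pres := pres_cls (repr u * repr v).
Definition pres_star (u : pres) : pres := pres_cls ((repr u) ^*).

Lemma pres_addE x y : pres_add (pres_cls x) (pres_cls y) = pres_cls (x + y).
Proof. by apply/pres_clsP/PE_add; apply: repr_pres_cls. Qed.
Lemma pres_oppE x : pres_opp (pres_cls x) = pres_cls ((-1)%R *: x).
Proof. by apply/pres_clsP/PE_scale/repr_pres_cls. Qed.
Lemma pres_scaleE a x : pres_scale a (pres_cls x) = pres_cls (a *: x).
Proof. by apply/pres_clsP/PE_scale/repr_pres_cls. Qed.
Lemma pres_mulE x y : pres_mul (pres_cls x) (pres_cls y) = pres_cls (x * y).
Proof. by apply/pres_clsP/PE_mul; apply: repr_pres_cls. Qed.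
Lemma pres_starE x : pres_star (pres_cls x) = pres_cls (x ^*).
Proof. by apply/pres_clsP/PE_star/repr_pres_cls. Qed.

Definition pres_E := (pres_addE, pres_oppE, pres_scaleE, pres_mulE, pres_starE).

Fact pres_addA : associative pres_add.
Proof.
move=> u v w; rewrite -(pres_clsK u) -(pres_clsK v) -(pres_clsK w) !pres_E.
exact/pres_clsP/PE_addA.
Qed.
Fact pres_addC : commutative pres_add.
Proof.
move=> u v; rewrite -(pres_clsK u) -(pres_clsK v) !pres_E.
exact/pres_clsP/PE_addC.
Qed.
Fact pres_add0 : left_id (pres_cls 0) pres_add.
Proof. by move=> u; rewrite -(pres_clsK u) !pres_E; apply/pres_clsP/PE_add0. Qed.
Fact pres_addN : left_inverse (pres_cls 0) pres_opp pres_add.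
Proof. by move=> u; rewrite -(pres_clsK u) !pres_E; apply/pres_clsP/PE_addN. Qed.

HB.instance Definition _ :=
  GRing.isZmodule.Build pres pres_addA pres_addC pres_add0 pres_addN.

Fact pres_scaleA a b u : pres_scale a (pres_scale b u) = pres_scale (a * b) u.
Proof. by rewrite -(pres_clsK u) !pres_E; apply/pres_clsP/PE_scaleA. Qed.
Fact pres_scale1 : left_id 1 pres_scale.
Proof. by move=> u; rewrite -(pres_clsK u) !pres_E; apply/pres_clsP/PE_scale1. Qed.
Fact pres_scaleDr : right_distributive pres_scale +%R.
Proof.
move=> a u v; rewrite -(pres_clsK u) -(pres_clsK v).
by rewrite /GRing.add/= !pres_E; apply/pres_clsP/PE_scaleDr.
Qed.
Fact pres_scaleDl u : {morph pres_scale^~ u : a b / a + b}.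
Proof.
move=> a b; rewrite -(pres_clsK u) [RHS]/GRing.add/= !pres_E.
exact/pres_clsP/PE_scaleDl.
Qed.

HB.instance Definition _ := GRing.Zmodule_isLmodule.Build K pres
  pres_scaleA pres_scale1 pres_scaleDr pres_scaleDl.

Fact pres_mulA : associative pres_mul.
Proof.
move=> u v w; rewrite -(pres_clsK u) -(pres_clsK v) -(pres_clsK w) !pres_E.
exact/pres_clsP/PE_mulA.
Qed.
Fact pres_mulDl : left_distributive pres_mul +%R.
Proof.
move=> u v w; rewrite -(pres_clsK u) -(pres_clsK v) -(pres_clsK w).
by rewrite /GRing.add/= !pres_E; apply/pres_clsP/PE_mulDl.
Qed.
Fact pres_mulDr : right_distributive pres_mul +%R.
Proof.
move=> u v w; rewrite -(pres_clsK u) -(pres_clsK v) -(pres_clsK w).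
by rewrite /GRing.add/= !pres_E; apply/pres_clsP/PE_mulDr.
Qed.
Fact pres_scale_mull (a : K) (u v : pres) :
  pres_mul (a *: u) v = a *: pres_mul u v.
Proof.
rewrite -(pres_clsK u) -(pres_clsK v) /GRing.scale/= !pres_E.
exact/pres_clsP/PE_scaleAl.
Qed.
Fact pres_scale_mulr (a : K) (u v : pres) :
  pres_mul u (a *: v) = a *: pres_mul u v.
Proof.
rewrite -(pres_clsK u) -(pres_clsK v) /GRing.scale/= !pres_E.
exact/pres_clsP/PE_scaleAr.
Qed.
Fact pres_starD (u v : pres) : pres_star (u + v) = pres_star u + pres_star v.
Proof.
rewrite -(pres_clsK u) -(pres_clsK v) /GRing.add/= !pres_E.
exact/pres_clsP/PE_starD.
Qed.
Fact pres_starZ (a : K) (u : pres) : pres_star (a *: u) = conj a *: pres_star u.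
Proof.
by rewrite -(pres_clsK u) /GRing.scale/= !pres_E; apply/pres_clsP/PE_starZ.
Qed.
Fact pres_starM (u v : pres) :
  pres_star (pres_mul u v) = pres_mul (pres_star v) (pres_star u).
Proof.
rewrite -(pres_clsK u) -(pres_clsK v) !pres_E.
exact/pres_clsP/PE_starM.
Qed.
Fact pres_starK : involutive pres_star.
Proof. by move=> u; rewrite -(pres_clsK u) !pres_E; apply/pres_clsP/PE_starK. Qed.

HB.instance Definition _ := Lmodule_isStarAlgebra.Build K conj pres
  pres_mulA pres_mulDl pres_mulDr pres_scale_mull pres_scale_mulr
  pres_starD pres_starZ pres_starM pres_starK.

Lemma pres_cls0 : pres_cls 0 = 0%R. Proof. by []. Qed.
Lemma pres_clsD x y : pres_cls (x + y) = (pres_cls x + pres_cls y)%R.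
Proof. by rewrite -pres_addE. Qed.
Lemma pres_clsZ a x : pres_cls (a *: x) = (a *: pres_cls x)%R.
Proof. by rewrite -pres_scaleE. Qed.
Lemma pres_clsM x y : pres_cls (x * y) = smul (pres_cls x) (pres_cls y).
Proof. by rewrite -pres_mulE. Qed.
Lemma pres_clsS x : pres_cls (x ^*) = star (pres_cls x).
Proof. by rewrite -pres_starE. Qed.
Lemma pres_cls_sum I (s : seq I) (F : I -> term K X) :
  pres_cls (\sum_(i <- s) F i)%ST = \sum_(i <- s) pres_cls (F i).
Proof. by apply: (big_morph pres_cls); [exact: pres_clsD | exact: pres_cls0]. Qed.

End Presentation.


(* [pres R] is the universal *-algebra generated by X subject to R. *)

Section Universal.
Variables (K : fieldType) (conj : {rmorphism K -> K}) (X : Type).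
Variable B : starAlgType conj.
Implicit Type f : X -> B.

Fixpoint eval f (t : term K X) : B :=
  match t with
  | TGen x => f x
  | TZero => 0
  | TAdd x y => eval f x + eval f y
  | TScale a x => a *: eval f x
  | TMul x y => smul (eval f x) (eval f y)
  | TStar x => star (eval f x)
  end.

Lemma eval_sum f I (s : seq I) (F : I -> term K X) :
  eval f (\sum_(i <- s) F i)%ST = \sum_(i <- s) eval f (F i).
Proof. exact: (big_morph (eval f)). Qed.

Variable R : term K X -> term K X -> Prop.

Definition pres_lift f (u : pres conj R) : B := eval f (repr u).

Lemma eval_pres_eq f x y : (forall x y, R x y -> eval f x = eval f y) ->
  pres_eq conj R x y -> eval f x = eval f y.
Proof.
move=> fR; elim=> {x y} /=; rewrite ?scale1r //.
- by move=> x y z _ -> _ ->.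
- by move=> x x' y y' _ -> _ ->.
- by move=> a x x' _ ->.
- by move=> x x' y y' _ -> _ ->.
- by move=> x x' _ ->.
- by move=> *; rewrite addrA.
- by move=> *; rewrite addrC.
- by move=> *; rewrite add0r.
- by move=> *; rewrite scaleN1r addNr.
- by move=> *; rewrite scalerA.
- by move=> *; rewrite scale1r.
- by move=> *; rewrite scalerDr.
- by move=> *; rewrite scalerDl.
- by move=> *; rewrite smulA.
- by move=> *; rewrite smulDl.
- by move=> *; rewrite smulDr.
- by move=> *; rewrite scale_smull.
- by move=> *; rewrite scale_smulr.
- by move=> *; rewrite starD.
- by move=> *; rewrite starZ.
- by move=> *; rewrite starM.
- by move=> *; rewrite starK.
Qed.

Lemma pres_lift_cls f x : (forall x y, R x y -> eval f x = eval f y) ->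
  pres_lift f (pres_cls conj R x) = eval f x.
Proof. by move=> fR; apply: (eval_pres_eq fR); apply: repr_pres_cls. Qed.

Lemma pres_lift_hom f : (forall x y, R x y -> eval f x = eval f y) ->
  star_hom (pres_lift f).
Proof.
move=> fR; split=> [a u v|u v|u].
- rewrite -(pres_clsK u) -(pres_clsK v) -pres_clsZ -pres_clsD.
  by rewrite !pres_lift_cls.
- by rewrite -(pres_clsK u) -(pres_clsK v) -pres_clsM !pres_lift_cls.
- by rewrite -(pres_clsK u) -pres_clsS !pres_lift_cls.
Qed.

Lemma pres_hom_cls (g : pres conj R -> B) x : star_hom g ->
  g (pres_cls conj R x) = eval (g \o @pres_gen K conj X R) x.
Proof.
move=> [gl gm gs].
have gD u v : g (u + v) = g u + g v.
  by have := gl 1 u v; rewrite !scale1r.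
have g0 : g 0 = 0.
  by apply: (addrI (g 0)); rewrite -gD !addr0.
have gZ a u : g (a *: u) = a *: g u.
  by have := gl a u 0; rewrite !addr0 g0 addr0.
elim: x => [//|//|x IHx y IHy|a x IHx|x IHx y IHy|x IHx] /=.
- by rewrite pres_clsD gD IHx IHy.
- by rewrite pres_clsZ gZ IHx.
- by rewrite pres_clsM gm IHx IHy.
- by rewrite pres_clsS gs IHx.
Qed.

Theorem pres_universal f : (forall x y, R x y -> eval f x = eval f y) ->
  exists! g : pres conj R -> B,
    star_hom g /\ forall x, g (pres_gen conj R x) = f x.
Proof.
move=> fR; exists (pres_lift f); split.
  by split=> [|x]; [exact: pres_lift_hom | rewrite pres_lift_cls].
move=> g [gh gf]; apply/funext => u; rewrite -(pres_clsK u).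
rewrite pres_lift_cls// pres_hom_cls//; congr eval.
by apply/funext => x /=; rewrite gf.
Qed.

End Universal.

Lemma pres_genR (K : fieldType) (conj : {rmorphism K -> K}) (X : Type)
    (R : term K X -> term K X -> Prop) x y :
  R x y -> eval (pres_gen conj R) x = eval (pres_gen conj R) y.
Proof.
have idh : star_hom (@id (pres conj R)) by [].
move=> Rxy; have := pres_hom_cls x idh; have := pres_hom_cls y idh => /= <- <-.
exact/pres_clsP/PE_rel.
Qed.

Record digraph := Digraph {
  vtx : choiceType;
  edge : choiceType;
  src : edge -> vtx;
  tgt : edge -> vtx }.
Arguments src {d}.
Arguments tgt {d}.

Definition out (E : digraph) (v : vtx E) : set (edge E) := [set e | src e = v].
Definition into (E : digraph) (v : vtx E) : set (edge E) := [set e | tgt e = v].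
Definition row_finite (E : digraph) : Prop :=
  forall v : vtx E, finite_set (out v).
Definition regular (E : digraph) (v : vtx E) : Prop := out v !=set0.
Definition isolated (E : digraph) (v : vtx E) : Prop :=
  out v = set0 /\ into v = set0.

Record wgraph := WGraph {
  wg :> digraph;
  wgt : edge wg -> nat;
  wg_row_finite : row_finite wg;
  wg_no_isolated : forall v : vtx wg, ~ isolated v;
  wgt_gt0 : forall e, (0 < wgt e)%N }.
Arguments wgt {w}.

(* The empty maximum is 0, so [vwgt v = 0] at sinks. *)
Definition vwgt (E : wgraph) (v : vtx E) : nat :=
  \max_(e <- fset_set (out v)) wgt e.

Definition vertex_weighted (E : wgraph) : Prop :=
  forall e : edge E, wgt e = vwgt (src e).

(* All indices i are shifted to start at 0: the generator e_i with
   1 <= i <= w(e) is [existT _ e i'] with i' = i - 1 : 'I_(wgt e). *)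

Section WeightedLPA.
Variables (K : fieldType) (conj : {rmorphism K -> K}) (E : wgraph).

Definition wgen : Type := (vtx E + {e : edge E & 'I_(wgt e)})%type.

Definition wV (v : vtx E) : term K wgen := TGen (inl v).

(* e_i, read as zero out of range *)
Definition wE (e : edge E) (i : nat) : term K wgen :=
  if (insub i : option 'I_(wgt e)) is Some i'
  then TGen (inr (existT _ e i')) else 0%ST.

Inductive wrel : term K wgen -> term K wgen -> Prop :=
| WR_vv u v : wrel (wV u * wV v) (if u == v then wV u else 0)%ST
| WR_vstar v : wrel (wV v) ((wV v)^*)
| WR_src e i : (i < wgt e)%N -> wrel (wV (src e) * wE e i) (wE e i)
| WR_tgt e i : (i < wgt e)%N -> wrel (wE e i) (wE e i * wV (tgt e))
| WR_row v i j : regular v -> (i < vwgt v)%N -> (j < vwgt v)%N ->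
    wrel (\sum_(e <- fset_set (out v)) (wE e i * (wE e j)^*))%ST
         (if i == j then wV v else 0)%ST
| WR_col v e f : regular v -> out v e -> out v f ->
    wrel (\sum_(i <- iota 0 (vwgt v)) ((wE e i)^* * wE f i))%ST
         (if e == f then wV (tgt e) else 0)%ST.

Definition wLPA : starAlgType conj := pres conj wrel.
Definition wLPA_v (v : vtx E) : wLPA := pres_cls conj wrel (wV v).
Definition wLPA_e (e : edge E) (i : nat) : wLPA := pres_cls conj wrel (wE e i).

End WeightedLPA.

Record sepGraph := SepGraph {
  sg :> digraph;
  sep : vtx sg -> set (set (edge sg));
  sepP : forall v : vtx sg, partition (sep v) id (out v) }.
Arguments sep {s}.

Section SepLPA.
Variables (K : fieldType) (conj : {rmorphism K -> K}) (F : sepGraph).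

Definition sgen : Type := (vtx F + edge F)%type.
Definition sV (v : vtx F) : term K sgen := TGen (inl v).
Definition sE (e : edge F) : term K sgen := TGen (inr e).

Inductive srel : term K sgen -> term K sgen -> Prop :=
| SR_vv u v : srel (sV u * sV v) (if u == v then sV u else 0)%ST
| SR_vstar v : srel (sV v) ((sV v)^*)
| SR_src e : srel (sV (src e) * sE e) (sE e)
| SR_tgt e : srel (sE e) (sE e * sV (tgt e))
| SR_col v (X : set (edge F)) e f : sep v X -> X e -> X f ->
    srel ((sE e)^* * sE f) (if e == f then sV (tgt e) else 0)%ST
| SR_row v (X : set (edge F)) : sep v X -> finite_set X ->
    srel (sV v) (\sum_(e <- fset_set X) (sE e * (sE e)^*))%ST.

Definition sLPA : starAlgType conj := pres conj srel.
Definition sLPA_v (v : vtx F) : sLPA := pres_cls conj srel (sV v).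
Definition sLPA_e (e : edge F) : sLPA := pres_cls conj srel (sE e).

End SepLPA.

(* Row-finite bipartite separated graphs with s(F^1) = F^{0,0} and
   r(F^1) = F^{0,1}; here F^{0,0} = [bup] and F^{0,1} = [blow]. *)
Record bipSepGraph := BipSepGraph {
  bup : choiceType;
  blow : choiceType;
  bedge : choiceType;
  bsrc : bedge -> bup;
  btgt : bedge -> blow;
  bsep : bup -> set (set bedge);
  bsepP : forall v, partition (bsep v) id [set e | bsrc e = v];
  b_row_finite : forall v, finite_set [set e | bsrc e = v];
  bsrc_surj : forall v, exists e, bsrc e = v;
  btgt_surj : forall w, exists e, btgt e = w }.
Arguments bsrc {b}.
Arguments btgt {b}.
Arguments bsep {b}.

Section BipSep.
Variable F : bipSepGraph.

(* F^0 is the disjoint union of F^{0,0} and F^{0,1}. *)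
Definition bip_digraph : digraph :=
  @Digraph (bup F + blow F)%type (bedge F) (inl \o bsrc) (inr \o btgt).

Definition bip_sep (x : vtx bip_digraph) : set (set (edge bip_digraph)) :=
  match x with inl v => bsep v | inr _ => set0 end.

Lemma bip_sepP (x : vtx bip_digraph) : partition (bip_sep x) id (out x).
Proof.
case: x => [v|w] /=.
  have -> : @out bip_digraph (inl v) = [set e | bsrc e = v].
    by apply/seteqP; split=> e; [case | move=> /= <-].
  exact: bsepP.
have -> : @out bip_digraph (inr w) = set0 by apply/seteqP; split.
by split; [exact: bigcup_set0 | move=> ? ? [] | move=> ? []].
Qed.

Definition bip_sepGraph : sepGraph := SepGraph bip_sepP.

(* X_e: the union of the (unique) class containing e *)
Definition bcls (e : bedge F) : set (bedge F) :=
  \bigcup_(X in [set X | bsep (bsrc e) X /\ X e]) X.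

Lemma bclsE v (X : set (bedge F)) e : bsep v X -> X e -> bcls e = X.
Proof.
move=> DX Xe; have [U T _] := bsepP v.
have ve : bsrc e = v.
  by have : cover (bsep v) id e by [exists X]; rewrite U.
apply/seteqP; split=> [f [Y [DY Ye] Yf]|f Xf]; last first.
  by exists X => //; rewrite /= ve.
rewrite /= ve in DY.
by have <- : Y = X by apply: (T _ _ DY DX); exists e.
Qed.

Lemma bclsP e : bsep (bsrc e) (bcls e) /\ bcls e e.
Proof.
have [U _ _] := bsepP (bsrc e).
have : cover (bsep (bsrc e)) id e by rewrite U.
by move=> [X DX Xe]; rewrite (bclsE DX Xe).
Qed.

Definition rho_ok (ef : bedge F * bedge F) : bool :=
  `[< bsrc ef.1 = bsrc ef.2 /\ bcls ef.1 <> bcls ef.2 >].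

End BipSep.

Section LowerLPA.
Variables (K : fieldType) (conj : {rmorphism K -> K}) (F : bipSepGraph).

Definition lgen : Type := (blow F + {ef : bedge F * bedge F | rho_ok ef})%type.

Definition lP (w : blow F) : term K lgen := TGen (inl w).

(* rho(e,f); the value 0 off the domain of rho is a convention never used. *)
Definition lRho (e f : bedge F) : term K lgen :=
  if (insub (e, f) : option {ef : bedge F * bedge F | rho_ok ef})
  is Some g then TGen (inr g) else 0%ST.

Inductive lrel : term K lgen -> term K lgen -> Prop :=
| LR_pp u w : lrel (lP u * lP w) (if u == w then lP u else 0)%ST
| LR_pstar w : lrel ((lP w)^*) (lP w)
| LR_star e f : rho_ok (e, f) -> lrel ((lRho e f)^*) (lRho f e)
| LR_right e f : rho_ok (e, f) -> lrel (lRho e f * lP (btgt f)) (lRho e f)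
| LR_left e f : rho_ok (e, f) -> lrel (lP (btgt e) * lRho e f) (lRho e f)
| LR_same e h (X : set (bedge F)) :
    bsrc e = bsrc h -> bsep (bsrc e) X -> X <> bcls e -> X <> bcls h ->
    bcls e = bcls h ->
    lrel (\sum_(f <- fset_set X) (lRho e f * lRho f h))%ST
         (if e == h then lP (btgt e) else 0)%ST
| LR_diff e h (X : set (bedge F)) :
    bsrc e = bsrc h -> bsep (bsrc e) X -> X <> bcls e -> X <> bcls h ->
    bcls e <> bcls h ->
    lrel (\sum_(f <- fset_set X) (lRho e f * lRho f h))%ST (lRho e h).

Definition lowerLPA : starAlgType conj := pres conj lrel.
Definition lowerLPA_p (w : blow F) : lowerLPA := pres_cls conj lrel (lP w).
Definition lowerLPA_rho (e f : bedge F) : lowerLPA :=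
  pres_cls conj lrel (lRho e f).

(* The identification of LW(F,D) with a corner of L(F,D). *)
Definition corner_gen (g : lgen) : sLPA conj (bip_sepGraph F) :=
  match g with
  | inl w => @sLPA_v K conj (bip_sepGraph F) (inr w)
  | inr ef => smul (star (@sLPA_e K conj (bip_sepGraph F) (val ef).1))
                   (@sLPA_e K conj (bip_sepGraph F) (val ef).2)
  end.

Definition corner : lowerLPA -> sLPA conj (bip_sepGraph F) :=
  pres_lift corner_gen (R := lrel).

Lemma corner_gen_rel (x y : term K lgen) :
  lrel x y -> eval corner_gen x = eval corner_gen y.
Proof.
pose L := sLPA conj (bip_sepGraph F).
pose V (v : vtx (bip_sepGraph F)) : L := sLPA_v conj v.
pose G (e : edge (bip_sepGraph F)) : L := sLPA_e conj e.
have sR a b : srel a b -> pres_cls conj (@srel K (bip_sepGraph F)) a =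
    pres_cls conj (@srel K (bip_sepGraph F)) b.
  by move=> ab; apply/pres_clsP/PE_rel.
have vv u v : smul (V u) (V v) = if u == v then V u else 0.
  by have := sR _ _ (SR_vv K u v); rewrite pres_clsM => ->; case: ifP.
have vs v : star (V v) = V v.
  by have := sR _ _ (SR_vstar K v); rewrite pres_clsS.
have gs e : smul (V (inl (bsrc e))) (G e) = G e.
  by have := sR _ _ (@SR_src K (bip_sepGraph F) e); rewrite pres_clsM.
have gt e : smul (G e) (V (inr (btgt e))) = G e.
  by have := sR _ _ (@SR_tgt K (bip_sepGraph F) e); rewrite pres_clsM.
have gc v (X : set (bedge F)) e f : bsep v X -> X e -> X f ->
    smul (star (G e)) (G f) = if e == f then V (inr (btgt e)) else 0.
  move=> DX Xe Xf.
  have := sR _ _ (@SR_col K (bip_sepGraph F) (inl v) X e f DX Xe Xf).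
  by rewrite pres_clsM pres_clsS => ->; case: ifP.
have gr v (X : set (bedge F)) : bsep v X -> finite_set X ->
    \sum_(e <- fset_set X) smul (G e) (star (G e)) = V (inl v).
  move=> DX fX.
  have := sR _ _ (@SR_row K (bip_sepGraph F) (inl v) X DX fX).
  rewrite pres_cls_sum => vE; rewrite [RHS]vE; apply: eq_bigr => e _.
  by rewrite pres_clsM pres_clsS.
have eP w : eval corner_gen (lP w) = V (inr w) by [].
have eRho e f : rho_ok (e, f) ->
    eval corner_gen (lRho e f) = smul (star (G e)) (G f).
  by rewrite /lRho => ok; case: insubP => [g _ /= ->//|]; rewrite ok.
clearbody V G.
have rho_okC (e f : bedge F) : rho_ok (e, f) -> rho_ok (f, e).
  by move=> /asboolP[/= ef nef]; apply/asboolP; split=> //= fe; exact: nef.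
have sumE e h (X : set (bedge F)) : bsrc e = bsrc h -> bsep (bsrc e) X ->
    X <> bcls e -> X <> bcls h ->
    eval corner_gen (\sum_(f <- fset_set X) (lRho e f * lRho f h))%ST =
    smul (star (G e)) (G h).
  move=> eh DX Xe Xh.
  have fX : finite_set X.
    apply: sub_finite_set (b_row_finite (bsrc e)).
    by have [<- _ _] := bsepP (bsrc e) => f Xf; exists X.
  have XP f : X f -> bsrc f = bsrc e /\ bcls f = X.
    move=> Xf; split; last exact: bclsE DX Xf.
    have [U _ _] := bsepP (bsrc e).
    by have : cover (bsep (bsrc e)) id f by [exists X]; rewrite U.
  transitivity (smul (smul (star (G e)) (V (inl (bsrc e)))) (G h)); last first.
    by rewrite -smulA eh gs.
  rewrite -(gr _ _ DX fX) eval_sum.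
  pose phi (u : L) := smul (smul (star (G e)) u) (G h).
  have phiD u v : phi (u + v) = phi u + phi v.
    by rewrite /phi smulDr smulDl.
  have phi0 : phi 0 = 0 by apply: (addrI (phi 0)); rewrite -phiD !addr0.
  rewrite -/(phi _) (big_morph phi phiD phi0).
  apply: eq_big_seq => f; rewrite in_fset_set// => /set_mem Xf.
  have [sf cf] := XP f Xf.
  rewrite /= !eRho; last 2 first.
  - by apply/asboolP; split=> /=; [rewrite sf eh | rewrite cf].
  - by apply/asboolP; split=> /=; [rewrite sf | rewrite cf => /esym].
  by rewrite /phi !smulA.
have eM a b : eval corner_gen (a * b)%ST =
    smul (eval corner_gen a) (eval corner_gen b) by [].
have eS a : eval corner_gen (a ^*)%ST = star (eval corner_gen a) by [].
have e0 : eval corner_gen 0%ST = 0 by [].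
case=> {x y}.
- move=> u w; rewrite eM fun_if e0 !eP vv.
  by rewrite (inj_eq (f := inr)) // => ? ? [].
- by move=> w; rewrite eS eP vs.
- move=> e f ok; rewrite eS (@eRho e f ok) (@eRho f e (@rho_okC e f ok)).
  by rewrite starM starK.
- by move=> e f ok; rewrite eM (@eRho e f ok) eP -smulA gt.
- by move=> e f ok; rewrite eM (@eRho e f ok) eP smulA -[V _]vs -starM gt.
- move=> e h X eh DX Xe Xh ceh; rewrite sumE// fun_if e0 eP.
  have [De ee] := bclsP e; have [_ hh] := bclsP h.
  by rewrite (gc _ _ _ _ De ee) ?ceh.
- move=> e h X eh DX Xe Xh ceh; rewrite sumE// eRho//.
  exact/asboolP.
Qed.

Lemma corner_hom : star_hom corner.
Proof. exact: (pres_lift_hom corner_gen_rel). Qed.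

Lemma corner_p w :
  corner (lowerLPA_p w) = @sLPA_v K conj (bip_sepGraph F) (inr w).
Proof. exact: (pres_lift_cls _ corner_gen_rel). Qed.

Lemma corner_rho e f : rho_ok (e, f) ->
  corner (lowerLPA_rho e f) =
  smul (star (@sLPA_e K conj (bip_sepGraph F) e))
       (@sLPA_e K conj (bip_sepGraph F) f).
Proof.
move=> ok; rewrite [LHS](pres_lift_cls _ corner_gen_rel) /lRho.
by case: insubP => [g _ /= ->//|]; rewrite ok.
Qed.

End LowerLPA.

(* The bipartite separated graph (E(w), C(w)) of a weighted graph. *)
Section SepOfWeighted.
Variable E : wgraph.

Definition wsep_up : choiceType := {v : vtx E | `[< regular v >]}.
Definition wsep_low : choiceType := vtx E.
(* [inl e] is the edge ~e, [inr (existT _ v i)] is h(v,i); there are no h(v,i)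
   at sinks, where vwgt v = 0. *)
Definition wsep_edge : choiceType :=
  (edge E + {v : vtx E & 'I_(vwgt v)})%type.

Definition tilde (e : edge E) : wsep_edge := inl e.
Definition hedge (v : vtx E) (i : 'I_(vwgt v)) : wsep_edge :=
  inr (existT _ v i).

Lemma regular_src (e : edge E) : `[< regular (src e) >].
Proof. by apply/asboolP; exists e. Qed.

Lemma regular_vwgt (v : vtx E) (i : 'I_(vwgt v)) : `[< regular v >].
Proof.
apply/asboolP; apply: contrapT => /set0P/negP/negPn/eqP v0.
by case: i => i; rewrite /vwgt v0 fset_set0 big_seq_fset0.
Qed.

Definition wsep_src (x : wsep_edge) : wsep_up :=
  match x with
  | inl e => exist _ (src e) (regular_src e)
  | inr (existT v i) => exist _ v (regular_vwgt i)
  end.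

Definition wsep_tgt (x : wsep_edge) : wsep_low :=
  match x with
  | inl e => tgt e
  | inr (existT v _) => v
  end.

Definition Xset (v : vtx E) : set wsep_edge := tilde @` out v.
Definition Yset (v : vtx E) : set wsep_edge := range (@hedge v).

Definition wsep_sep (v : wsep_up) : set (set wsep_edge) :=
  [set Xset (val v); Yset (val v)].

Lemma wsep_src_tilde v e : (wsep_src (tilde e) = v) <-> out (val v) e.
Proof. by split=> [<-//|ve]; apply/val_inj. Qed.

Lemma wsep_sepP (v : wsep_up) :
  partition (wsep_sep v) id [set x | wsep_src x = v].
Proof.
have vreg : regular (val v) by exact/asboolP/(valP v).
split.
- apply/seteqP; split=> [x [Z [->|->]] | [e|[u i]] xv].
  + by move=> [e ve <-]; exact/wsep_src_tilde.
  + by move=> [i _ <-]; exact/val_inj.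
  + by exists (Xset (val v)); [left | exists e => //; exact/wsep_src_tilde].
  + exists (Yset (val v)); first by right.
    by rewrite -xv /=; exists i.
- by move=> A B [->|->] [->|->] // [x [[a _ <-] [b _]]].
- move=> Z [->|->].
  + by have [e ve] := vreg; exists (tilde e), e.
  + have [e ve] := vreg.
    have v0 : (0 < vwgt (val v))%N.
      apply: leq_trans (wgt_gt0 e) _; rewrite /vwgt.
      apply: leq_bigmax_seq => //=.
      by rewrite in_fset_set; [exact/mem_set | exact: wg_row_finite].
    by exists (hedge (Ordinal v0)), (Ordinal v0).
Qed.

Lemma wsep_row_finite (v : wsep_up) :
  finite_set [set x | wsep_src x = v].
Proof.
have [<- _ _] := wsep_sepP v.
rewrite /cover /wsep_sep bigcup_setU1 bigcup_set1 finite_setU; split.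
  by apply: finite_image; exact: wg_row_finite.
exact/finite_image/finite_finset.
Qed.

Lemma wsep_src_surj (v : wsep_up) : exists x, wsep_src x = v.
Proof.
by have /asboolP[e ve] := valP v; exists (tilde e); exact/wsep_src_tilde.
Qed.

Lemma wsep_tgt_surj (w : wsep_low) : exists x, wsep_tgt x = w.
Proof.
have [wreg|nreg] := pselect (regular w).
  have /asboolT wr := wreg.
  have [_ _ /(_ (Yset w))] := wsep_sepP (exist _ w wr).
  by case=> [|x [i _ _]]; [right | exists (hedge i)].
have [[e we]|ninto] := pselect (into w !=set0); first by exists (tilde e).
case: (@wg_no_isolated E w); split; apply: contrapT => /eqP/set0P; contradiction.
Qed.

Definition wsep : bipSepGraph :=
  BipSepGraph wsep_sepP wsep_row_finite wsep_src_surj wsep_tgt_surj.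

(* Phi(e_i) is a genuine generator: h(s(e),i) and ~e have the same source and
   lie in the distinct classes Y_{s(e)} and X_{s(e)}. *)
Lemma wsep_rho_ok (e : edge E) (i : 'I_(vwgt (src e))) :
  @rho_ok wsep (hedge i, tilde e).
Proof.
have se : wsep_src (hedge i) = wsep_src (tilde e) by exact/val_inj.
apply/asboolP; split=> //.
rewrite /= (@bclsE wsep (wsep_src (tilde e)) (Yset (src e)))//; last 2 first.
- by right.
- by exists i.
rewrite (@bclsE wsep (wsep_src (tilde e)) (Xset (src e)))//; last 2 first.
- by left.
- by exists e.
by move=> YX; have : Yset (src e) (hedge i) by [exists i]; rewrite YX => -[].
Qed.

End SepOfWeighted.

(* Main.v *)
Require Import Defs.
From HB Require Import structures.
From mathcomp Require Import all_boot all_order all_algebra.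
From mathcomp Require Import all_classical finmap.

Set Implicit Arguments.
Unset Strict Implicit.
Unset Printing Implicit Defensive.

Import GRing.Theory.

Local Open Scope ring_scope.

(** The separated graph of a vertex weighted graph has exactly two classes at
    each upper vertex [v], namely [X_v] (the edges of the graph) and [Y_v] (the
    edges [h(v,i)]).  Hence the generators of the lower Leavitt path algebra
    are the projections [p_v], the elements [rho(h(v,i), ~e)] with [s(e) = v],
    and the adjoints [rho(~e, h(v,i))] of the latter: up to adjoints, these
    are the generators [v] and [e_i] of the weighted Leavitt path algebra.

    The defining relations match as well.  Consider the sum
    [sum_f rho(x, f) rho(f, y)] over a class at [v] containing neither of the
    edges [x] and [y].  If both lie in [Y_v], the class must be [X_v], and the
    relation reads
    [sum_e rho(h(v,i), ~e) rho(~e, h(v,j)) = delta_ij p_v], which is the row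
    relation [sum_e e_i e_j^* = delta_ij v].  If both lie in [X_v], the sum is
    over [Y_v] and gives the column relation
    [sum_i e_i^* f_i = delta_ef r(e)].  If they lie in different classes, a
    third class at [v] would be required, so that relation is vacuous.

    Therefore the assignments on generators in both directions respect the
    relations ([lower_of_wgen_rel] and [weighted_of_lgen_rel]), and the two
    induced homomorphisms are mutually inverse because they are so on
    generators.  Vertex weightedness enters in that [e_i] is defined for all
    [i <= w(s(e))], which are precisely the indices of the [h(s(e),i)]. *)

(** * Homomorphisms out of a presented algebra *)

Section Presented.
Variables (K : fieldType) (conj : {rmorphism K -> K}).

Lemma star_hom_comp (A B C : starAlgType conj) (g : B -> C) (f : A -> B) :
  star_hom g -> star_hom f -> star_hom (g \o f).
Proof.
move=> [gl gm gs] [fl fm fs].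
by split=> [a u v|u v|u] /=; rewrite ?fl ?gl ?fm ?gm ?fs ?gs.
Qed.

Variables (X : Type) (R : term K X -> term K X -> Prop).

Lemma pres_cls_rel x y : R x y -> pres_cls conj R x = pres_cls conj R y.
Proof. by move=> Rxy; apply/pres_clsP/PE_rel. Qed.

Lemma pres_hom_ext (B : starAlgType conj) (f g : pres conj R -> B) :
  star_hom f -> star_hom g ->
  (forall x, f (pres_gen conj R x) = g (pres_gen conj R x)) -> f = g.
Proof.
move=> fh gh fg; apply/funext => u; rewrite -(pres_clsK u) !pres_hom_cls//.
by congr eval; apply/funext.
Qed.

Lemma pres_endo_id (f : pres conj R -> pres conj R) :
  star_hom f ->
  (forall x, f (pres_gen conj R x) = pres_gen conj R x) -> forall u, f u = u.
Proof.
move=> fh fx u.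
have -> : f = id by apply: (pres_hom_ext fh) => // ; split.
by [].
Qed.

End Presented.

(** * Classes and sums in the separated graph of a weighted graph *)

Lemma big_fset_set_seq (V : nmodType) (T : choiceType) (A : set T) (s : seq T)
    (F : T -> V) :
  uniq s -> (forall x, A x <-> x \in s) ->
  \sum_(x <- fset_set A) F x = \sum_(x <- s) F x.
Proof.
move=> us As; apply/perm_big/uniq_perm => // x.
have fA : finite_set A.
  by apply/finite_seqP; exists s; apply/seteqP; split=> y /As.
rewrite in_fset_set//; apply/idP/idP => [/set_mem/As//|xs].
exact/mem_set/As.
Qed.

Lemma big_iota0 (V : nmodType) n (F : nat -> V) :
  \sum_(i <- iota 0 n) F i = \sum_(i < n) F i.
Proof. by rewrite -[n in iota 0 n]subn0 big_mkord. Qed.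

Lemma bsep_src (F : bipSepGraph) v (X : set (bedge F)) z :
  bsep v X -> X z -> bsrc z = v.
Proof.
move=> DX Xz; have [U _ _] := bsepP v.
by have : cover (bsep v) id z by [exists X]; rewrite U.
Qed.

Lemma bsep_finite (F : bipSepGraph) v (X : set (bedge F)) :
  bsep v X -> finite_set X.
Proof.
move=> DX; apply: sub_finite_set (b_row_finite v) => z.
exact: bsep_src.
Qed.

Section SepClasses.
Variable E : wgraph.
Implicit Types (v : vtx E) (e f : edge E) (x y : wsep_edge E).

Lemma big_Xset (V : nmodType) v (F : wsep_edge E -> V) :
  \sum_(x <- fset_set (Xset v)) F x = \sum_(e <- fset_set (out v)) F (tilde e).
Proof.
rewrite -(big_map (@tilde E) xpredT F); apply: big_fset_set_seq.
  by rewrite map_inj_uniq ?fset_uniq// => ? ? [].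
have fo := @wg_row_finite E v.
move=> x; split=> [[e ve <-]|/mapP[e]].
  by apply: map_f; rewrite in_fset_set//; exact/mem_set.
by rewrite in_fset_set// => /set_mem ve ->; exists e.
Qed.

(** The index is read off by a function of the whole edge, as the pair of [v]
    and [i] is a dependent one. *)
Lemma hedge_inj v : injective (@hedge E v).
Proof.
move=> i j ij; apply/val_inj.
exact: (congr1 (fun x : wsep_edge E =>
  if x is inr (existT _ k) then nat_of_ord k else 0%N) ij).
Qed.

Lemma hedge_eq v (i j : 'I_(vwgt v)) : (hedge i == hedge j) = (i == j).
Proof. exact/inj_eq/hedge_inj. Qed.

Lemma big_Yset (V : nmodType) v (F : wsep_edge E -> V) :
  \sum_(x <- fset_set (Yset v)) F x = \sum_(i < vwgt v) F (hedge i).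
Proof.
rewrite -(big_map (@hedge E v) xpredT F); apply: big_fset_set_seq.
  by rewrite map_inj_uniq ?index_enum_uniq//; exact: hedge_inj.
move=> x; split=> [[i _ <-]|/mapP[i _ ->]]; last by exists i.
by apply: map_f; exact: mem_index_enum.
Qed.

Lemma bcls_tilde e : @bcls (wsep E) (tilde e) = Xset (src e).
Proof.
apply: (@bclsE (wsep E) (wsep_src (tilde e))); first by left.
by exists e.
Qed.

Lemma bcls_hedge v (i : 'I_(vwgt v)) : @bcls (wsep E) (hedge i) = Yset v.
Proof.
apply: (@bclsE (wsep E) (wsep_src (hedge i))); first by right.
by exists i.
Qed.

Lemma Xset_neq_Yset_out v e : src e = v -> Xset v <> Yset v.
Proof.
by move=> ve XY; have [] : Yset v (tilde e) by rewrite -XY; exists e.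
Qed.

Lemma rho_ok_hedge_tilde v (i : 'I_(vwgt v)) e :
  src e = v -> @rho_ok (wsep E) (hedge i, tilde e).
Proof. by move=> ve; subst v; exact: wsep_rho_ok. Qed.

Lemma rho_okC (F : bipSepGraph) (x y : bedge F) :
  rho_ok (x, y) -> rho_ok (y, x).
Proof. by move=> /asboolP[/= xy nxy]; apply/asboolP; split=> //= /esym. Qed.

Lemma src_hedge_tilde v (i : 'I_(vwgt v)) e :
  wsep_src (hedge i) = wsep_src (tilde e) <-> src e = v.
Proof. by split=> [/(congr1 val)|ve]; [|apply/val_inj; rewrite /= ve]. Qed.

(** There being two classes at each vertex, a pair in the domain of [rho]
    consists of an edge [~e] and an edge [h(s(e),i)], in either order. *)
Variant rho_ok_spec : wsep_edge E -> wsep_edge E -> Prop :=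
| RhoOkYX e (i : 'I_(vwgt (src e))) : rho_ok_spec (hedge i) (tilde e)
| RhoOkXY e (i : 'I_(vwgt (src e))) : rho_ok_spec (tilde e) (hedge i).

Lemma rho_okP x y : @rho_ok (wsep E) (x, y) -> rho_ok_spec x y.
Proof.
move=> /asboolP[]; case: x => [e|[v i]]; case: y => [f|[u j]].
- move=> /(congr1 val) /= ef; case; rewrite -/(tilde e) -/(tilde f).
  by rewrite !bcls_tilde ef.
- move=> /esym/src_hedge_tilde eu _; subst u; exact: RhoOkXY.
- move=> /src_hedge_tilde eu _; subst v; exact: RhoOkYX.
- move=> /(congr1 val) /= uv; subst u; case.
  by rewrite -/(hedge i) -/(hedge j) !bcls_hedge.
Qed.

End SepClasses.

(** * The two homomorphisms *)

Section WeightedLower.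
Variables (K : fieldType) (conj : {rmorphism K -> K}) (E : wgraph).
Hypothesis vwE : vertex_weighted E.

Local Notation LE := (wLPA conj E).
Local Notation LW := (lowerLPA conj (wsep E)).
Local Notation pV := (@lowerLPA_p K conj (wsep E)).
Local Notation rho := (@lowerLPA_rho K conj (wsep E)).
Local Notation wv := (@wLPA_v K conj E).
Local Notation we := (@wLPA_e K conj E).

(** The cast is where the graph has to be vertex weighted: with indices starting
    at 0, [e_i] exists for [i < w(e)], whereas [h(s(e),i)] exists for
    [i < w(s(e))]. *)
Definition lower_of_wgen (g : wgen E) : LW :=
  match g with
  | inl v => pV v
  | inr (existT e i) => rho (hedge (cast_ord (vwE e) i)) (tilde e)
  end.

Lemma eval_lower_wE v (i : 'I_(vwgt v)) e :
  src e = v ->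
  eval lower_of_wgen (wE K e i) = rho (hedge i) (tilde e).
Proof.
move=> ve; subst v; have iw : (i < wgt e)%N by rewrite vwE.
rewrite /wE (insubT (fun k => (k < wgt e)%N) iw) /=.
by congr (rho (hedge _) _); apply/val_inj.
Qed.

Lemma smul_p u v : smul (pV u) (pV v) = if u == v then pV u else 0.
Proof. by rewrite -pres_clsM (pres_cls_rel _ (LR_pp _ _ _)); case: ifP. Qed.

Lemma star_p v : star (pV v) = pV v.
Proof. by rewrite -pres_clsS (pres_cls_rel _ (LR_pstar _ _)). Qed.

Lemma star_rho x y : @rho_ok (wsep E) (x, y) -> star (rho x y) = rho y x.
Proof. by move=> ok; rewrite -pres_clsS (pres_cls_rel _ (LR_star _ ok)). Qed.

(** The images of the row relations: two edges of [Y_v] lie in the same class,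
    and the remaining class to sum over is [X_v]; it differs from [Y_v] since
    [v] emits an edge. *)
Lemma lower_row v (i j : 'I_(vwgt v)) : regular v ->
  \sum_(e <- fset_set (out v))
     smul (rho (hedge i) (tilde e)) (rho (tilde e) (hedge j)) =
  if i == j then pV v else 0.
Proof.
move=> [e0 ve0]; have XY := Xset_neq_Yset_out ve0.
rewrite -(big_Xset v (fun x => smul (rho (hedge i) x) (rho x (hedge j)))).
have ss : @bsrc (wsep E) (hedge i) = @bsrc (wsep E) (hedge j) by exact/val_inj.
have DX : @bsep (wsep E) (@bsrc (wsep E) (hedge i)) (Xset v) by left.
have Xi : Xset v <> @bcls (wsep E) (hedge i) by rewrite bcls_hedge.
have Xj : Xset v <> @bcls (wsep E) (hedge j) by rewrite bcls_hedge.
have ij : @bcls (wsep E) (hedge i) = @bcls (wsep E) (hedge j).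
  by rewrite !bcls_hedge.
have := pres_cls_rel conj (LR_same K ss DX Xi Xj ij).
rewrite pres_cls_sum hedge_eq (fun_if (pres_cls conj _)) => <-.
by apply: eq_bigr => x _; rewrite pres_clsM.
Qed.

(** The images of the column relations, with the roles of [X_v] and [Y_v]
    exchanged. *)
Lemma lower_col v e f : src e = v -> src f = v ->
  \sum_(i < vwgt v)
     smul (rho (tilde e) (hedge i)) (rho (hedge i) (tilde f)) =
  if e == f then pV (tgt e) else 0.
Proof.
move=> ev fv; have XY := Xset_neq_Yset_out ev.
rewrite -(big_Yset v (fun x => smul (rho (tilde e) x) (rho x (tilde f)))).
have ss : @bsrc (wsep E) (tilde e) = @bsrc (wsep E) (tilde f).
  by apply/val_inj; rewrite /= ev fv.
have DY : @bsep (wsep E) (@bsrc (wsep E) (tilde e)) (Yset v).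
  by right; rewrite /= ev.
have Ye : Yset v <> @bcls (wsep E) (tilde e).
  by rewrite bcls_tilde ev => /esym.
have Yf : Yset v <> @bcls (wsep E) (tilde f).
  by rewrite bcls_tilde fv => /esym.
have ef : @bcls (wsep E) (tilde e) = @bcls (wsep E) (tilde f).
  by rewrite !bcls_tilde ev fv.
have := pres_cls_rel conj (LR_same K ss DY Ye Yf ef).
rewrite pres_cls_sum (fun_if (pres_cls conj _)) => sE.
rewrite -[e == f]/(tilde e == tilde f) -[RHS]sE.
by apply: eq_bigr => x _; rewrite pres_clsM.
Qed.

Lemma lower_of_wgen_rel x y :
  wrel x y -> eval lower_of_wgen x = eval lower_of_wgen y.
Proof.
case=> {x y}.
- by move=> u v /=; rewrite smul_p; case: eqP.
- by move=> v /=; rewrite star_p.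
- move=> e i; rewrite vwE => iw.
  rewrite /= (eval_lower_wE (Ordinal iw) (erefl (src e))).
  have ok := rho_ok_hedge_tilde (Ordinal iw) (erefl (src e)).
  by rewrite -pres_clsM (pres_cls_rel _ (LR_left _ ok)).
- move=> e i; rewrite vwE => iw.
  rewrite /= (eval_lower_wE (Ordinal iw) (erefl (src e))).
  have ok := rho_ok_hedge_tilde (Ordinal iw) (erefl (src e)).
  by rewrite -pres_clsM (pres_cls_rel _ (LR_right _ ok)).
- move=> v i j vreg iv jv; rewrite eval_sum.
  rewrite (fun_if (eval lower_of_wgen)).
  have /= <- := lower_row (Ordinal iv) (Ordinal jv) vreg.
  apply: eq_big_seq => e.
  rewrite in_fset_set; last exact: wg_row_finite.
  move=> /set_mem ve /=.
  rewrite (eval_lower_wE (Ordinal iv) ve) (eval_lower_wE (Ordinal jv) ve).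
  by rewrite star_rho// rho_ok_hedge_tilde.
- move=> v e f _ ve vf; rewrite eval_sum big_iota0.
  rewrite (fun_if (eval lower_of_wgen)).
  have /= <- := lower_col ve vf.
  apply: eq_bigr => i _ /=.
  rewrite (eval_lower_wE i ve) (eval_lower_wE i vf).
  by rewrite star_rho// rho_ok_hedge_tilde.
Qed.

(** The index of [e_i] being a plain natural number, this can be a total
    function of two edges, free of the condition that [h(v,i)] and [~e] start
    at the same vertex; on the domain of [rho] it inverts the assignment
    [e_i |-> rho(h(s(e),i), ~e)] and is compatible with adjoints. *)
Definition weighted_of_rho (x y : wsep_edge E) : LE :=
  match x, y with
  | inr (existT _ i), inl e => we e i
  | inl e, inr (existT _ i) => star (we e i)
  | _, _ => 0
  end.

Definition weighted_of_lgen (g : lgen (wsep E)) : LE :=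
  match g with
  | inl v => wv v
  | inr xy => weighted_of_rho (val xy).1 (val xy).2
  end.

Lemma eval_weighted_lRho x y : @rho_ok (wsep E) (x, y) ->
  eval weighted_of_lgen (@lRho K (wsep E) x y) = weighted_of_rho x y.
Proof.
by move=> ok; rewrite /lRho; case: insubP => [xy _ /= ->//|]; rewrite ok.
Qed.

Lemma smul_wv u v : smul (wv u) (wv v) = if u == v then wv u else 0.
Proof. by rewrite -pres_clsM (pres_cls_rel _ (WR_vv _ _ _)); case: ifP. Qed.

Lemma star_wv v : star (wv v) = wv v.
Proof. by rewrite -pres_clsS -(pres_cls_rel _ (WR_vstar _ _)). Qed.

Lemma smul_src_we e (i : 'I_(vwgt (src e))) :
  smul (wv (src e)) (we e i) = we e i.
Proof.
have iw : (i < wgt e)%N by rewrite vwE.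
by rewrite -pres_clsM (pres_cls_rel _ (WR_src _ iw)).
Qed.

Lemma smul_we_tgt e (i : 'I_(vwgt (src e))) :
  smul (we e i) (wv (tgt e)) = we e i.
Proof.
have iw : (i < wgt e)%N by rewrite vwE.
by rewrite -pres_clsM -(pres_cls_rel _ (WR_tgt _ iw)).
Qed.

Lemma weighted_row v (i j : 'I_(vwgt v)) :
  \sum_(e <- fset_set (out v)) smul (we e i) (star (we e j)) =
  if i == j then wv v else 0.
Proof.
have vreg : regular v by exact/asboolP/(regular_vwgt i).
have := pres_cls_rel conj (WR_row K vreg (ltn_ord i) (ltn_ord j)).
rewrite pres_cls_sum (fun_if (pres_cls conj _)) => <-.
by apply: eq_bigr => e _; rewrite pres_clsM pres_clsS.
Qed.

Lemma weighted_col v e f : src e = v -> src f = v ->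
  \sum_(i < vwgt v) smul (star (we e i)) (we f i) =
  if e == f then wv (tgt e) else 0.
Proof.
move=> ve vf; have vreg : regular v by exists e.
have := pres_cls_rel conj (WR_col K vreg ve vf).
rewrite pres_cls_sum big_iota0 (fun_if (pres_cls conj _)) => <-.
by apply: eq_bigr => i _; rewrite pres_clsM pres_clsS.
Qed.

(** The relations on [p] and the adjoints are immediate. For the sums over a
    class, the position of [x] and [y] in [X_v] or [Y_v] forces which class is
    summed over, leaving the row and column relations. *)
Lemma weighted_of_lgen_rel x y :
  lrel x y -> eval weighted_of_lgen x = eval weighted_of_lgen y.
Proof.
case=> {x y}.
- by move=> u v /=; rewrite smul_wv; case: eqP.
- by move=> v /=; rewrite star_wv.
- move=> x y ok /=; rewrite !eval_weighted_lRho//; last exact: rho_okC.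
  by case: (rho_okP ok) => e i //=; rewrite starK.
- move=> x y ok /=; rewrite !eval_weighted_lRho//.
  case: (rho_okP ok) => e i /=; first exact: smul_we_tgt.
  by rewrite -[wv _]star_wv -starM smul_src_we.
- move=> x y ok /=; rewrite !eval_weighted_lRho//.
  case: (rho_okP ok) => e i /=; first exact: smul_src_we.
  by rewrite -[wv _]star_wv -starM smul_we_tgt.
- move=> x y X xy DX Xx Xy cxy; rewrite eval_sum.
  rewrite (fun_if (eval weighted_of_lgen)).
  have -> : \sum_(z <- fset_set X) eval weighted_of_lgen
        (@lRho K (wsep E) x z * @lRho K (wsep E) z y)%ST =
      \sum_(z <- fset_set X) smul (weighted_of_rho x z) (weighted_of_rho z y).
    have fX := bsep_finite DX.
    apply: eq_big_seq => z; rewrite in_fset_set// => /set_mem Xz.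
    have zx := bsep_src DX Xz; have cz := bclsE DX Xz.
    have xz : @rho_ok (wsep E) (x, z).
      by apply/asboolP; split=> /=; [exact: esym|rewrite cz => /esym].
    have zy : @rho_ok (wsep E) (z, y).
      by apply/asboolP; split=> /=; [exact: etrans xy|rewrite cz].
    by rewrite /= !eval_weighted_lRho.
  case: x y xy DX Xx Xy cxy => [e|[v i]] [f|[u j]].
  + move=> /(congr1 val) /= ef.
    rewrite -/(tilde e) -/(tilde f) !bcls_tilde => -[->//|-> _ _ _].
    by rewrite big_Yset; apply: weighted_col.
  + move=> /esym/src_hedge_tilde eu; subst u.
    rewrite -/(tilde e) -/(hedge j) bcls_tilde bcls_hedge => _ _ _.
    by move/(Xset_neq_Yset_out (erefl _)).
  + move=> /src_hedge_tilde eu; subst v.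
    rewrite -/(tilde f) -/(hedge i) bcls_tilde bcls_hedge => _ _ _.
    by move/esym/(Xset_neq_Yset_out (erefl _)).
  + move=> /(congr1 val) /= uv; subst u.
    rewrite -/(hedge i) -/(hedge j) !bcls_hedge hedge_eq => -[->|->//] _ _ _.
    by rewrite big_Xset; apply: weighted_row.
(* Here [x] and [y] already occupy both classes at their source, so no class
   [X] avoiding both exists. *)
- move=> x y X xy DX Xx Xy cxy.
  have ok : @rho_ok (wsep E) (x, y) by exact/asboolP.
  case: (rho_okP ok) DX Xx Xy => e i.
  + by rewrite bcls_tilde bcls_hedge => -[].
  + by rewrite bcls_tilde bcls_hedge => -[].
Qed.

Definition lower_of_weighted : LE -> LW :=
  pres_lift lower_of_wgen (R := @wrel K E).

Definition weighted_of_lower : LW -> LE :=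
  pres_lift weighted_of_lgen (R := @lrel K (wsep E)).

Lemma lower_of_weighted_hom : star_hom lower_of_weighted.
Proof. exact: (pres_lift_hom lower_of_wgen_rel). Qed.

Lemma weighted_of_lower_hom : star_hom weighted_of_lower.
Proof. exact: (pres_lift_hom weighted_of_lgen_rel). Qed.

Lemma lower_of_weighted_v v : lower_of_weighted (wv v) = pV v.
Proof. exact: (pres_lift_cls _ lower_of_wgen_rel). Qed.

Lemma lower_of_weighted_e e (i : 'I_(vwgt (src e))) :
  lower_of_weighted (we e i) = rho (hedge i) (tilde e).
Proof.
by rewrite [LHS](pres_lift_cls _ lower_of_wgen_rel) eval_lower_wE.
Qed.

Lemma weighted_of_lower_p v : weighted_of_lower (pV v) = wv v.
Proof. exact: (pres_lift_cls _ weighted_of_lgen_rel). Qed.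

Lemma weighted_of_lower_rho x y : @rho_ok (wsep E) (x, y) ->
  weighted_of_lower (rho x y) = weighted_of_rho x y.
Proof.
move=> ok.
by rewrite [LHS](pres_lift_cls _ weighted_of_lgen_rel) eval_weighted_lRho.
Qed.

Lemma wgen_we e (i : 'I_(wgt e)) :
  pres_gen conj (@wrel K E) (inr (existT _ e i)) = we e (cast_ord (vwE e) i).
Proof.
rewrite /wLPA_e /wE /= (insubT (fun k => (k < wgt e)%N) (ltn_ord i)) /=.
by congr (pres_gen _ _ (inr (existT _ e _))); apply/val_inj.
Qed.

Lemma lgen_rho (xy : {xy | @rho_ok (wsep E) xy}) :
  pres_gen conj (@lrel K (wsep E)) (inr xy) = rho (val xy).1 (val xy).2.
Proof.
rewrite /lowerLPA_rho /lRho -surjective_pairing.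
by rewrite valK.
Qed.

Lemma lower_of_weightedK : cancel lower_of_weighted weighted_of_lower.
Proof.
apply: (@pres_endo_id _ _ _ _ (weighted_of_lower \o lower_of_weighted)).
  exact: star_hom_comp weighted_of_lower_hom lower_of_weighted_hom.
case=> [v|[e i]] /=.
  by rewrite [X in weighted_of_lower X]lower_of_weighted_v weighted_of_lower_p.
by rewrite wgen_we lower_of_weighted_e weighted_of_lower_rho// wsep_rho_ok.
Qed.

Lemma weighted_of_lowerK : cancel weighted_of_lower lower_of_weighted.
Proof.
apply: (@pres_endo_id _ _ _ _ (lower_of_weighted \o weighted_of_lower)).
  exact: star_hom_comp lower_of_weighted_hom weighted_of_lower_hom.
case=> [v|[[x y] ok]] /=.
  by rewrite [X in lower_of_weighted X]weighted_of_lower_p lower_of_weighted_v.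
rewrite lgen_rho /= weighted_of_lower_rho//.
case: (rho_okP ok) => e i /=; first exact: lower_of_weighted_e.
have [_ _ ->] := lower_of_weighted_hom.
by rewrite lower_of_weighted_e star_rho// wsep_rho_ok.
Qed.

End WeightedLower.

Theorem theorem2p12 (K : fieldType) (conj : {rmorphism K -> K})
    (conjK : involutive conj) (E : wgraph) (vwE : vertex_weighted E) :
  let spec (Phi : wLPA conj E -> lowerLPA conj (wsep E)) : Prop :=
    [/\ star_iso Phi,
        forall v : vtx E, Phi (wLPA_v conj v) = @lowerLPA_p K conj (wsep E) v
      & forall (e : edge E) (i : 'I_(vwgt (src e))),
          Phi (wLPA_e conj e i) =
          @lowerLPA_rho K conj (wsep E) (hedge i) (tilde e)] in
  (exists! Phi, spec Phi) /\
  (forall Phi, spec Phi ->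
    (forall v : vtx E,
       corner (Phi (wLPA_v conj v)) =
       @sLPA_v K conj (bip_sepGraph (wsep E)) (inr v)) /\
    (forall (e : edge E) (i : 'I_(vwgt (src e))),
       corner (Phi (wLPA_e conj e i)) =
       smul (star (@sLPA_e K conj (bip_sepGraph (wsep E)) (hedge i)))
            (@sLPA_e K conj (bip_sepGraph (wsep E)) (tilde e)))).
Proof.
set spec := fun Phi => _.
have spec_ok : spec (lower_of_weighted vwE).
  split; [split|exact: lower_of_weighted_v|exact: lower_of_weighted_e].
    exact: lower_of_weighted_hom.
  exists (@weighted_of_lower K conj E).
    exact: lower_of_weightedK.
  exact: weighted_of_lowerK.
split.
  exists (lower_of_weighted vwE); split=> // Phi [[PhiH _] PhiV PhiE].
  apply: pres_hom_ext => //; first exact: lower_of_weighted_hom.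
  case=> [v|[e i]].
    by rewrite [RHS]PhiV; exact: lower_of_weighted_v.
  by rewrite (wgen_we conj vwE) PhiE lower_of_weighted_e.
move=> Phi [_ PhiV PhiE]; split=> [v|e i].
  by rewrite PhiV corner_p.
by rewrite PhiE corner_rho// wsep_rho_ok.
Qed.
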